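(* Let $k$ be a positive integer. The map $\mathrm{pre}_k$, restricted to the set $\mathcal S_k$ of partitions $\lambda$ such that either $m_\lambda(1)\ge k$, or $m_\lambda(1)=k-1$ and $m_\lambda(p)\ge 1$ for some prime $p$, is injective. That is, if $\lambda,\mu\in\mathcal S_k$ and $\mathrm{pre}_k(\lambda)=\mathrm{pre}_k(\mu)$, then $\lambda=\mu$. No restriction is placed on the sizes of $\lambda$ and $\mu$.
   Context: A partition $\lambda=(\lambda_1,\ldots,\lambda_\ell)$ is a weakly decreasing finite sequence of positive integers; $\ell$ is its length and $\sum_i\lambda_i$ its size. For a positive integer $i$, $m_\lambda(i)$ denotes the number of parts of $\lambda$ equal to $i$. For $k\le \ell$, $\mathrm{pre}_k(\lambda)$ is the partition whose parts are the $\binom{\ell}{k}$ products $\lambda_{i_1}\lambda_{i_2}\cdots\lambda_{i_k}$ over all index sets $1\le i_1<\cdots<i_k\le \ell$ (listed with multiplicity and sorted in weakly decreasing order), i.e. the summands of the elementary symmetric polynomial $e_k(\lambda_1,\ldots,\lambda_\ell)$. If $\ell<k$, $\mathrm{pre}_k(\lambda)$ is undefined. *)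

(* Defs.v *)
From HB Require Import structures.
From mathcomp Require Import all_boot.

Set Implicit Arguments.
Unset Strict Implicit.
Unset Printing Implicit Defensive.

(* Integer partitions; equality of partitions is equality of the sequences
   of parts (val_inj). *)
Record intpart := IntPart {
  parts :> seq nat;
  _ : sorted geq parts && (0 \notin parts)
}.

HB.instance Definition _ := [isSub for parts].
HB.instance Definition _ := [Equality of intpart by <:].

Definition mult (l : intpart) (i : nat) : nat := count_mem i l.

Definition pre_seq (k : nat) (l : seq nat) : seq nat :=
  sort geq [seq \prod_(i in A) nth 0 l i
           | A : {set 'I_(size l)} in [set B : {set 'I_(size l)} | #|B| == k]].

Lemma pre_seq_subproof (k : nat) (l : intpart) :
  sorted geq (pre_seq k l) && (0 \notin pre_seq k l).
Proof.
apply/andP; split; first by apply: sort_sorted => x y; exact: leq_total.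
rewrite mem_sort; apply/imageP => -[A _] /esym/eqP; apply/negP.
rewrite -lt0n; apply: prodn_cond_gt0 => i _; rewrite lt0n.
by apply: contraNneq (proj2 (andP (valP l))) => /= <-; exact: mem_nth.
Qed.

(* The map pre_k is only meant for size l >= k; otherwise pre k l is the junk
   value [::]. This case does not occur on inS k, see inS_size. *)
Definition pre (k : nat) (l : intpart) : intpart :=
  IntPart (pre_seq_subproof k l).

Lemma size_pre (k : nat) (l : intpart) : size (pre k l) = 'C(size l, k).
Proof. by rewrite size_sort size_image card_draws card_ord. Qed.

Definition inS (k : nat) (l : intpart) : Prop :=
  k <= mult l 1 \/
  (mult l 1 = k - 1 /\ exists p : nat, prime p /\ 1 <= mult l p).

Lemma inS_size (k : nat) (l : intpart) : inS k l -> k <= size l.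
Proof.
case=> [/leq_trans -> // | [m1 [p [p_pr mp]]]]; first exact: count_size.
have no1p : count (predI (pred1 1) (pred1 p)) l = 0.
  rewrite (@eq_count _ _ pred0) ?count_pred0 // => x /=.
  by case: eqP => // ->; case: eqP p_pr => // <-.
have := count_predUI (pred1 1) (pred1 p) l; rewrite no1p addn0 => e.
have := count_size (predU (pred1 1) (pred1 p)) l.
rewrite e; apply: leq_trans; rewrite -/(mult l 1) m1 -leq_subLR.
by apply: leq_trans mp; rewrite leq_subLR addnC -leq_subLR.
Qed.

(* Main.v *)
Require Import Defs.
From mathcomp Require Import all_boot.

(** The multiplicity of 1 in [pre_k] is ['C(a, k)] with [a] the number of parts
    equal to 1; as [a >= k - 1] on [S_k], this determines [a].  A product of [k]
    parts equal to [m > 1] either uses only parts smaller than [m], or consists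
    of one part [m] and [k - 1] parts 1.  Hence the multiplicity of [m] in
    [pre_k] is ['C(a, k - 1)] times the multiplicity of [m] in the partition
    plus a quantity depending only on the parts smaller than [m]; since
    ['C(a, k - 1) > 0], strong induction on [m] recovers the partition. *)

Set Implicit Arguments.
Unset Strict Implicit.
Unset Printing Implicit Defensive.

(** Splitting index sets by whether they contain [ord0] is what makes [pre_seq] accessible to
    induction on the list. *)
Lemma big_set_ord_recl n (F : {set 'I_n.+1} -> nat) :
  \sum_A F A = \sum_(B : {set 'I_n}) F (ord0 |: lift ord0 @: B)
             + \sum_(B : {set 'I_n}) F (lift ord0 @: B).
Proof.
have inj0 := @lift_inj n.+1 ord0.
have n0 (B : {set 'I_n}) : (ord0 \in lift ord0 @: B) = false.
  by apply/imsetP => -[i _ /eqP]; rewrite (negPf (neq_lift _ _)).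
have liftK (B : {set 'I_n}) : lift ord0 @^-1: (lift ord0 @: B) = B.
  by apply/setP=> i; rewrite inE mem_imset.
have liftUK (B : {set 'I_n}) : lift ord0 @^-1: (ord0 |: lift ord0 @: B) = B.
  by apply/setP=> i; rewrite !inE eq_sym (negPf (neq_lift _ _)) mem_imset.
rewrite (bigID (fun A : {set _} => ord0 \in A)) /=; congr (_ + _).
  rewrite (reindex_onto (fun B : {set 'I_n} => ord0 |: lift ord0 @: B)
                        (fun A => lift ord0 @^-1: A)) /=.
    by apply: eq_bigl => B; rewrite liftUK eqxx setU11.
  move=> A A0; apply/setP=> i; rewrite !inE.
  by case: (unliftP ord0 i) => [j|] ->; rewrite ?eqxx // mem_imset // inE
     eq_sym (negPf (neq_lift _ _)).
rewrite (reindex_onto (fun B : {set 'I_n} => lift ord0 @: B)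
                      (fun A => lift ord0 @^-1: A)) /=.
  by apply: eq_bigl => B; rewrite liftK eqxx n0.
move=> A /negPf A0; apply/setP=> i.
by case: (unliftP ord0 i) => [j|] ->; rewrite ?n0 ?A0 // mem_imset // inE.
Qed.

Lemma count_pre_seqE (p : pred nat) k s :
  count p (pre_seq k s) = \sum_(A : {set 'I_(size s)})
     ((#|A| == k) && p (\prod_(i in A) nth 0 s i)).
Proof.
rewrite /pre_seq count_sort /image_mem count_map -sum1_count big_enum_cond /=.
rewrite big_mkcond /=; apply: eq_bigr => A _; rewrite inE.
by case: (_ && _).
Qed.

Lemma count_pre_seq0 (p : pred nat) s : count p (pre_seq 0 s) = p 1.
Proof.
rewrite count_pre_seqE (bigD1 set0) //= cards0 big_set0 big1 ?addn0 //.
by move=> A /negPf A0; rewrite cards_eq0 A0.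
Qed.

Lemma count_pre_seq_nil (p : pred nat) k : count p (pre_seq k.+1 [::]) = 0.
Proof.
rewrite count_pre_seqE big1 // => A _.
by have := max_card A; rewrite card_ord leqn0 => /eqP->.
Qed.

(** A chosen factor [x] is absorbed into the predicate, which avoids dividing by [x]; hence the
    counts are stated for arbitrary [p]. *)
Lemma count_pre_seq_cons (p : pred nat) k x s :
  count p (pre_seq k.+1 (x :: s)) =
  count (fun t => p (x * t)) (pre_seq k s) + count p (pre_seq k.+1 s).
Proof.
rewrite !count_pre_seqE big_set_ord_recl /=.
have inj0 := @lift_inj (size s).+1 ord0.
have n0 (B : {set 'I_(size s)}) : ord0 \notin lift ord0 @: B.
  by apply/imsetP => -[i _ /eqP]; rewrite (negPf (neq_lift _ _)).
have prodE (B : {set 'I_(size s)}) :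
    \prod_(i in lift ord0 @: B) nth 0 (x :: s) i = \prod_(i in B) nth 0 s i.
  by rewrite big_imset //= => i j _ _; apply: inj0.
congr (_ + _); apply: eq_bigr => B _.
  by rewrite cardsU1 n0 card_imset // big_setU1 //= prodE.
by rewrite card_imset // prodE.
Qed.

Lemma count1_pre_seq k s :
  count_mem 1 (pre_seq k s) = 'C(count_mem 1 s, k).
Proof.
elim: s k => [|x s IH] [|k]; rewrite ?count_pre_seq0 ?bin0 //.
  by rewrite count_pre_seq_nil.
rewrite count_pre_seq_cons IH /=; case: eqP => [->|/eqP x1].
  rewrite add1n binS addnC -(IH k); congr (_ + _).
  by apply: eq_count => t /=; rewrite mul1n.
rewrite (@eq_count _ _ pred0) ?count_pred0 // => t /=.
by rewrite muln_eq1 (negPf x1).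
Qed.

(** A product of positive parts is at least each of its factors, so no part [>= M] enters a product
    satisfying [p]. *)
Lemma count_pre_seq_filter (p : pred nat) M k s :
  0 \notin s -> ~~ p 0 -> (forall t, p t -> t < M) ->
  count p (pre_seq k s) = count p (pre_seq k [seq x <- s | x < M]).
Proof.
elim: s k p => [//|x s IH] [|k] p; first by rewrite !count_pre_seq0.
rewrite inE negb_or eq_sym -lt0n => /andP[x0 s0] p0 pM.
rewrite count_pre_seq_cons (IH k.+1 p) //=; case: ltnP => [xM|Mx].
  rewrite count_pre_seq_cons; congr (_ + _); apply: IH; rewrite ?muln0 //.
  by move=> t /pM; apply: leq_ltn_trans; rewrite leq_pmull.
(* The predicates are compared at every natural [t], including 0, where [x * t] is not bounded below
   by [x]. *)
rewrite (@eq_count _ _ pred0) ?count_pred0 // => -[|t] /=.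
  by rewrite muln0 (negPf p0).
apply/negP => /pM; rewrite ltnNge (leq_trans Mx) //.
by rewrite leq_pmulr.
Qed.

Lemma count_pre_seq k m s : 1 < m -> 0 \notin s ->
  count_mem m (pre_seq k.+1 s) =
  count_mem m (pre_seq k.+1 [seq x <- s | x < m])
    + count_mem m s * 'C(count_mem 1 s, k).
Proof.
move=> m1; elim: s k => [|x s IH] k.
  by rewrite /= !count_pre_seq_nil.
rewrite inE negb_or eq_sym -lt0n => /andP[x0 s0].
rewrite count_pre_seq_cons IH //=.
have [xm|mx|->] := ltngtP x m; last first.
(* For [x = m] the other [k] factors must multiply to 1. *)
- rewrite (gtn_eqF m1) add0n add1n mulSn addnCA; congr (_ + (_ + _)).
  rewrite -count1_pre_seq; apply: eq_count => t /=.
  by rewrite -{2}[m]muln1 eqn_pmul2l // ltnW.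
- rewrite (gtn_eqF (ltn_trans m1 mx)) !add0n.
  rewrite (@eq_count _ _ pred0) ?count_pred0 // => -[|t] /=.
    by rewrite muln0 ltn_eqF // ltnW.
  by rewrite gtn_eqF // (leq_trans mx) // leq_pmulr.
rewrite add0n count_pre_seq_cons.
(* For [x = 1] the two induction hypotheses combine by Pascal's rule; [k = 0] is apart, the
   hypothesis covering only nonempty products. *)
have [->|x1] := eqVneq x 1.
  have mul1 : (fun t => pred1 m (1 * t)) =1 pred1 m by move=> t; rewrite mul1n.
  rewrite !(eq_count mul1) add1n; case: k => [|k].
    by rewrite !count_pre_seq0 !bin0 addnA.
  by rewrite IH // binS mulnDr addnACA; congr (_ + _); rewrite addnC.
rewrite add0n addnA; congr (_ + _ + _).
(* Here [1 < x < m], so a cofactor [t] with [x * t = m] is below [m] and uses only parts below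
   [m]. *)
apply: count_pre_seq_filter => // [|t /= /eqP xtm].
  by rewrite muln0 /= ltn_eqF // ltnW.
have t0 : 0 < t by case: t xtm m1 => [<-|//]; rewrite muln0.
by rewrite -xtm ltn_Pmull // ltn_neqAle eq_sym x1.
Qed.

Lemma inS_mult1 k l : inS k l -> k.-1 <= mult l 1.
Proof.
case=> [|[-> _]]; last by rewrite subn1.
exact: leq_trans (leq_pred k).
Qed.

(** By Pascal's rule ['C(a.+1, k)] exceeds ['C(a, k)] by ['C(a, k.-1)], which is positive once
    [k.-1 <= a]. *)
Lemma bin_inj_pred k a b : 0 < k -> k.-1 <= a -> k.-1 <= b ->
  'C(a, k) = 'C(b, k) -> a = b.
Proof.
case: k => //= k _.
wlog ab : a b / a < b => [H|] ka kb E.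
  by have [/H|/H|] := ltngtP a b => // ->.
suff : 'C(a, k.+1) < 'C(b, k.+1) by rewrite E ltnn.
apply: leq_trans (leq_bin2l k.+1 ab).
by rewrite binS -addn1 leq_add2l bin_gt0.
Qed.

Lemma sorted_geq_eq (s t : seq nat) : sorted geq s -> sorted geq t ->
  (forall x, count_mem x s = count_mem x t) -> s = t.
Proof.
move=> ss st st_count; apply: (sorted_eq _ _ ss st).
- by move=> y x z /= yx zy; apply: leq_trans zy yx.
- by move=> x y /andP[xy yx]; apply/eqP; rewrite eqn_leq; apply/andP.
- by apply/allP=> x _ /=; rewrite st_count.
Qed.

Theorem theorem2p3 (k : nat) (k_gt0 : 0 < k) (lam mu : intpart) :
  inS k lam -> inS k mu -> pre k lam = pre k mu -> lam = mu.
Proof.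
move=> /inS_mult1 lam1 /inS_mult1 mu1 /(congr1 parts) /= E.
have ones : mult lam 1 = mult mu 1.
  by apply: (bin_inj_pred k_gt0) => //; rewrite -!count1_pre_seq E.
have /andP[slam lam0] := valP lam; have /andP[smu mu0] := valP mu.
apply: val_inj; apply: (sorted_geq_eq slam smu) => m.
elim/ltn_ind: m => -[|[|m]] IH //.
  by rewrite !(count_memPn _).
case: k k_gt0 lam1 mu1 E => //= k _ lam1 mu1 E.
(* Equal multiplicities below [m.+2] give equal sorted lists, so the contributions of smaller parts
   cancel. *)
have small : [seq x <- lam | x < m.+2] = [seq x <- mu | x < m.+2].
  have tr : transitive geq by move=> y x z /= yx zy; apply: leq_trans zy yx.
  apply: sorted_geq_eq; rewrite ?(sorted_filter tr) // => x.
  rewrite !count_filter; case: (ltnP x m.+2) => xm.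
    by rewrite -!(@eq_count _ (pred1 x)) ?IH // => y /=;
       case: eqP => // ->; rewrite xm.
  by rewrite !(@eq_count _ _ pred0) ?count_pred0 // => y /=;
     case: eqP => // ->; rewrite ltnNge xm.
have := congr1 (count_mem m.+2) E.
rewrite (count_pre_seq _ _ lam0) // (count_pre_seq _ _ mu0) // small => /addnI /eqP.
by rewrite -/(mult lam 1) ones eqn_pmul2r ?bin_gt0 // => /eqP.
Qed.
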